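(* A nontrivial graph product $\Gamma\mathcal G$ such that $|G_{\tilde v}|\geq 3$ for some vertex $\tilde v$ recognizes coordinates if and only if the complement graph $\bar\Gamma$ of $\Gamma$ is connected. Moreover, the class of all nontrivial graph products $\Gamma\mathcal G$ such that $\bar\Gamma$ is connected and $|G_v|\geq 3$ for some vertex $v$ of $\Gamma$ recognizes coordinates.
   Context: For a graph $\Gamma=(V,E)$ (of arbitrary cardinality) and groups $\mathcal G=\{G_v\mid v\in V\}$, the graph product $\Gamma\mathcal G$ is the free product $*_{v\in V}G_v$ modulo the normal subgroup generated by $\{aba^{-1}b^{-1}\mid a\in G_v,b\in G_w,\{v,w\}\in E\}$. It is nontrivial if $|V|\geq 2$ and $|G_v|\geq 2$ for all $v\in V$. The complement is $\bar\Gamma=(V,\bar E)$ where $\bar E$ is the set of non-edges. A single group $G$ recognizes coordinates if the class $\{G\}$ does. Reduced product: for an ideal $\mathcal I$ on $\mathbb I$ (closed under subsets and finite unions, $\mathbb I\notin\mathcal I$), $\prod_{\mathcal I}G_i$ is $\prod_iG_i$ modulo $(a_i)\simeq(b_i)\iff\{i\mid a_i\ne b_i\}\in\mathcal I$; for $S\in\mathcal P(\mathbb I)/\mathcal I$, $\mathcal M\restriction S$ is the quotient onto a representative of $S$, with quotient map $\pi_S$. An isomorphism $\Phi:\prod_{\mathcal I}G_i\to\prod_{\mathcal J}H_j$ is isomorphically coordinate respecting if there is an isomorphism $\alpha:\mathcal P(\mathbb I)/\mathcal I\to\mathcal P(\mathbb J)/\mathcal J$ such that for all $S$ the map $\pi_S(a)\mapsto\pi_{\alpha(S)}(\Phi(a))$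 is well defined. A class recognizes coordinates if every isomorphism between reduced products (any index sets, ideals, repetitions allowed) of its members is isomorphically coordinate respecting. *)

(* Defs.v *)
From Stdlib Require Import Relation_Operators.
From HB Require Import structures.
From mathcomp Require Import all_boot all_order.
From mathcomp Require Import monoid generic_quotient.
From mathcomp Require Import boolp classical_sets.
Set Implicit Arguments.
Unset Strict Implicit.
Unset Printing Implicit Defensive.

Local Open Scope group_scope.
Local Open Scope quotient_scope.
Local Open Scope classical_set_scope.

(* A congruence of a monoid whose quotient is a group; [gc_inv] picks
   two-sided inverses modulo the congruence. *)
Record group_congr (M : monoidType) := GroupCongr {
  gc_rel :> M -> M -> Prop;
  gc_refl : forall x, gc_rel x x;
  gc_sym : forall x y, gc_rel x y -> gc_rel y x;
  gc_trans : forall x y z, gc_rel x y -> gc_rel y z -> gc_rel x z;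
  gc_mul : forall x x' y y',
    gc_rel x x' -> gc_rel y y' -> gc_rel (x * y) (x' * y');
  gc_inv : M -> M;
  gc_mulV : forall x, gc_rel (gc_inv x * x) 1;
  gc_mulrV : forall x, gc_rel (x * gc_inv x) 1
}.

Section QuotientGroup.
Variables (M : monoidType) (C : group_congr M).

Definition gc_relb : rel M := fun x y => `[< C x y >].

Lemma gc_relb_equiv : equiv_class_of gc_relb.
Proof.
split=> [x|x y|y x z].
- by apply/asboolP/gc_refl.
- by apply/asboolP/asboolP => /gc_sym.
- by move=> /asboolP xy /asboolP yz; apply/asboolP/(gc_trans xy).
Qed.

Definition gc_equiv : equiv_rel M := EquivRelPack gc_relb_equiv.

Definition quotg : Type := {eq_quot gc_equiv}.
HB.instance Definition _ := Choice.on quotg.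
HB.instance Definition _ := EqQuotient.on quotg.

Lemma quotgP (x y : M) : \pi_quotg x = \pi_quotg y <-> C x y.
Proof.
split=> [/eqP|Cxy].
  by rewrite eqmodE => /asboolP.
by apply/eqP; rewrite eqmodE; apply/asboolP.
Qed.

Definition quotg_mul (x y : quotg) : quotg := \pi_quotg (repr x * repr y).
Definition quotg_inv (x : quotg) : quotg := \pi_quotg (gc_inv C (repr x)).

Lemma gc_repr (x : M) : C (repr (\pi_quotg x)) x.
Proof. by apply/quotgP; rewrite reprK. Qed.

Lemma quotg_pi_mul (x y : M) :
  quotg_mul (\pi_quotg x) (\pi_quotg y) = \pi_quotg (x * y).
Proof. by apply/quotgP/gc_mul; exact: gc_repr. Qed.

Lemma quotg_mulA : associative quotg_mul.
Proof.
elim/quotW=> x; elim/quotW=> y; elim/quotW=> z.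
by rewrite (quotg_pi_mul y) (quotg_pi_mul x y) !quotg_pi_mul mulgA.
Qed.

Lemma quotg_mul1 : left_id (\pi_quotg 1) quotg_mul.
Proof. by move=> x; rewrite -[x]reprK quotg_pi_mul mul1g. Qed.

Lemma quotg_mulr1 : right_id (\pi_quotg 1) quotg_mul.
Proof. by move=> x; rewrite -[x]reprK quotg_pi_mul mulg1. Qed.

Lemma quotg_mulV : left_inverse (\pi_quotg 1) quotg_inv quotg_mul.
Proof.
move=> x; rewrite -{2}[x]reprK quotg_pi_mul.
by apply/quotgP/gc_mulV.
Qed.

Lemma quotg_mulrV : right_inverse (\pi_quotg 1) quotg_inv quotg_mul.
Proof.
move=> x; rewrite -{1}[x]reprK quotg_pi_mul.
by apply/quotgP/gc_mulrV.
Qed.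

HB.instance Definition _ := isGroup.Build quotg
  quotg_mulA quotg_mul1 quotg_mulr1 quotg_mulV quotg_mulrV.

Lemma quotg_piM (x y : M) : \pi_quotg (x * y) = \pi_quotg x * \pi_quotg y.
Proof. by rewrite -quotg_pi_mul. Qed.

Lemma quotg_pi1 : \pi_quotg (1 : M) = 1.
Proof. by []. Qed.

End QuotientGroup.

Record normal_subgroup (G : groupType) (N : set G) : Prop := NormalSubgroup {
  nsub1 : N 1;
  nsubM : forall x y, N x -> N y -> N (x * y);
  nsubV : forall x, N x -> N x^-1;
  nsubJ : forall x y, N x -> N (y * x * y^-1)
}.

Definition normal_closure (G : groupType) (A : set G) : set G :=
  [set x | forall N : set G, normal_subgroup N -> A `<=` N -> N x].

Lemma normal_closure_normal (G : groupType) (A : set G) :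
  normal_subgroup (normal_closure A).
Proof.
split=> [N nN _|x y Ax Ay N nN AN|x Ax N nN AN|x y Ax N nN AN].
- exact: nsub1.
- by apply: nsubM => //; [exact: Ax|exact: Ay].
- by apply: nsubV => //; exact: Ax.
- by apply: nsubJ => //; exact: Ax.
Qed.

Section NormalCongr.
Variables (G : groupType) (N : set G) (nN : normal_subgroup N).

Definition normal_rel (x y : G) : Prop := N (x * y^-1).

Lemma normal_rel_refl x : normal_rel x x.
Proof. by rewrite /normal_rel mulgV; exact: nsub1. Qed.

Lemma normal_rel_sym x y : normal_rel x y -> normal_rel y x.
Proof. by move=> /(nsubV nN); rewrite invgM invgK. Qed.

Lemma normal_rel_trans x y z :
  normal_rel x y -> normal_rel y z -> normal_rel x z.
Proof.
by move=> xy yz; have := nsubM nN xy yz; rewrite mulgA mulgVK.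
Qed.

Lemma normal_rel_mul x x' y y' :
  normal_rel x x' -> normal_rel y y' -> normal_rel (x * y) (x' * y').
Proof.
move=> xx' yy'; have := nsubM nN (nsubJ nN x yy') xx'.
by rewrite /normal_rel invgM !mulgA mulgVK.
Qed.

Lemma normal_rel_mulV x : normal_rel (x^-1 * x) 1.
Proof. by rewrite mulVg; exact: normal_rel_refl. Qed.

Lemma normal_rel_mulrV x : normal_rel (x * x^-1) 1.
Proof. by rewrite mulgV; exact: normal_rel_refl. Qed.

Definition normal_congr : group_congr G :=
  GroupCongr normal_rel_refl normal_rel_sym normal_rel_trans normal_rel_mul
    normal_rel_mulV normal_rel_mulrV.

End NormalCongr.

Section FreeProduct.
Variables (V : Type) (G : V -> groupType).

Definition letter : Type := {classic {v : V & G v}}.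
HB.instance Definition _ := Choice.on letter.

Definition lett (v : V) (a : G v) : letter := existT _ v a.

Definition word : Type := seq letter.
HB.instance Definition _ := Choice.on word.
HB.instance Definition _ := isMonoid.Build word
  (@catA letter) (@cat0s letter) (@cats0 letter).

Inductive word_eq : word -> word -> Prop :=
| word_eq1 v : word_eq [:: lett (1 : G v)] [::]
| word_eqM v (a b : G v) : word_eq [:: lett a; lett b] [:: lett (a * b)]
| word_eq_refl s : word_eq s s
| word_eq_sym s t : word_eq s t -> word_eq t s
| word_eq_trans s t u : word_eq s t -> word_eq t u -> word_eq s u
| word_eq_cat s s' t t' :
    word_eq s s' -> word_eq t t' -> word_eq (s ++ t) (s' ++ t').

Definition letter_inv (l : letter) : letter := lett (projT2 l)^-1.
Definition word_inv (s : word) : word := rev (map letter_inv s).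

Lemma letter_invK : involutive letter_inv.
Proof. by case=> v a; rewrite /letter_inv /lett /= invgK. Qed.

Lemma word_invK : involutive word_inv.
Proof. by move=> s; rewrite /word_inv map_rev revK (mapK letter_invK). Qed.

Lemma word_mulrV (s : word) : word_eq (s ++ word_inv s) [::].
Proof.
elim: s => [|[v a] s IHs]; first exact: word_eq_refl.
rewrite /word_inv /= rev_cons -cats1 -/(word_inv s).
apply: (@word_eq_trans _ ([:: lett a] ++ [:: lett a^-1])).
  apply: (@word_eq_cat [:: lett a] [:: lett a]); first exact: word_eq_refl.
  rewrite catA; apply: (@word_eq_cat _ [::]); first exact: IHs.
  exact: word_eq_refl.
apply: word_eq_trans (word_eqM _ _) _.
by rewrite mulgV; exact: word_eq1.
Qed.

Lemma word_mulV (s : word) : word_eq (word_inv s ++ s) [::].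
Proof. by rewrite -{2}[s]word_invK; exact: word_mulrV. Qed.

Definition word_congr : group_congr word :=
  @GroupCongr word word_eq word_eq_refl word_eq_sym word_eq_trans word_eq_cat
    word_inv word_mulV word_mulrV.

Definition free_product : groupType := quotg word_congr.

Definition fp_in (v : V) (a : G v) : free_product :=
  \pi_(quotg word_congr) [:: lett a].

Lemma fp_inM (v : V) (a b : G v) : fp_in (a * b) = fp_in a * fp_in b.
Proof.
rewrite /fp_in -(quotg_piM word_congr); apply/quotgP.
exact/word_eq_sym/word_eqM.
Qed.

End FreeProduct.

Record graph (V : Type) := Graph {
  adj :> V -> V -> Prop;
  adj_sym : forall v w, adj v w -> adj w v;
  adj_irrefl : forall v, ~ adj v v
}.

Section Complement.
Variables (V : Type) (Gamma : graph V).

Definition coadj (v w : V) : Prop := v <> w /\ ~ Gamma v w.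

Lemma coadj_sym v w : coadj v w -> coadj w v.
Proof.
by move=> [vw nvw]; split=> [/esym//|/(@adj_sym _ Gamma)/nvw].
Qed.

Lemma coadj_irrefl v : ~ coadj v v.
Proof. by case. Qed.

Definition complement : graph V := Graph coadj_sym coadj_irrefl.

End Complement.

Definition graph_connected (V : Type) (Gamma : graph V) : Prop :=
  inhabited V /\ forall v w : V, clos_refl_trans V Gamma v w.

Section GraphProduct.
Variables (V : Type) (Gamma : graph V) (G : V -> groupType).

Definition gp_relators : set (free_product G) :=
  [set x | exists v w (a : G v) (b : G w),
     Gamma v w /\ x = fp_in a * fp_in b * (fp_in a)^-1 * (fp_in b)^-1].

Definition graph_product : groupType :=
  quotg (normal_congr (normal_closure_normal gp_relators)).

End GraphProduct.

Definition card_at_least (n : nat) (T : Type) : Prop :=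
  exists f : 'I_n -> T, injective f.

(* Nontriviality of the graph product of the family [G] (independent of the
   edges). *)
Definition gp_nontrivial (V : Type) (G : V -> groupType) : Prop :=
  card_at_least 2 V /\ forall v, card_at_least 2 (G v).

(* Properness is kept apart, because the restriction of an ideal to one of its
   members is improper. *)
Record ideal (I : Type) := Ideal {
  ideal_set :> set I -> Prop;
  ideal0 : ideal_set set0;
  idealU : forall A B, ideal_set A -> ideal_set B -> ideal_set (A `|` B);
  idealS : forall A B, A `<=` B -> ideal_set B -> ideal_set A
}.

Definition proper_ideal (I : Type) (J : ideal I) : Prop := ~ J setT.

Section PiGroup.
Variables (I : Type) (G : I -> groupType).

Definition pi_group : Type := forall i, G i.
HB.instance Definition _ := Choice.on pi_group.

Definition pi_mul (a b : pi_group) : pi_group := fun i => a i * b i.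
Definition pi_one : pi_group := fun i => 1.
Definition pi_inv (a : pi_group) : pi_group := fun i => (a i)^-1.

Lemma pi_mulA : associative pi_mul.
Proof. by move=> a b c; apply: functional_extensionality_dep => i; exact: mulgA. Qed.
Lemma pi_mul1 : left_id pi_one pi_mul.
Proof. by move=> a; apply: functional_extensionality_dep => i; exact: mul1g. Qed.
Lemma pi_mulr1 : right_id pi_one pi_mul.
Proof. by move=> a; apply: functional_extensionality_dep => i; exact: mulg1. Qed.
Lemma pi_mulV : left_inverse pi_one pi_inv pi_mul.
Proof. by move=> a; apply: functional_extensionality_dep => i; exact: mulVg. Qed.
Lemma pi_mulrV : right_inverse pi_one pi_inv pi_mul.
Proof. by move=> a; apply: functional_extensionality_dep => i; exact: mulgV. Qed.

HB.instance Definition _ := isGroup.Build pi_group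
  pi_mulA pi_mul1 pi_mulr1 pi_mulV pi_mulrV.

End PiGroup.

Section ReducedProduct.
Variables (I : Type) (J : ideal I) (G : I -> groupType).

Definition rp_rel (a b : pi_group G) : Prop := J [set i | a i <> b i].

Lemma rp_rel_refl a : rp_rel a a.
Proof. by apply: idealS (ideal0 J) => i /=. Qed.

Lemma rp_rel_sym a b : rp_rel a b -> rp_rel b a.
Proof. by apply: idealS => i /= ab /esym. Qed.

Lemma rp_rel_trans a b c : rp_rel a b -> rp_rel b c -> rp_rel a c.
Proof.
move=> ab bc; apply: idealS (idealU ab bc) => i /= ac.
by have [eab|] := EM (a i = b i); [right; rewrite -eab|left].
Qed.

Lemma rp_rel_mul a a' b b' :
  rp_rel a a' -> rp_rel b b' -> rp_rel (a * b) (a' * b').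
Proof.
move=> aa' bb'; apply: idealS (idealU aa' bb') => i /= nab.
have [eaa'|] := EM (a i = a' i); [right => ebb'|by left].
by apply: nab; rewrite /mul /= /pi_mul eaa' ebb'.
Qed.

Lemma rp_rel_mulV (a : pi_group G) : rp_rel (a^-1 * a) 1.
Proof. by rewrite mulVg; exact: rp_rel_refl. Qed.

Lemma rp_rel_mulrV (a : pi_group G) : rp_rel (a * a^-1) 1.
Proof. by rewrite mulgV; exact: rp_rel_refl. Qed.

Definition rp_congr : group_congr (pi_group G) :=
  GroupCongr rp_rel_refl rp_rel_sym rp_rel_trans rp_rel_mul
    rp_rel_mulV rp_rel_mulrV.

Definition reduced_product : groupType := quotg rp_congr.

Definition rp_class (a : pi_group G) : reduced_product :=
  \pi_(quotg rp_congr) a.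
Definition rp_repr (x : reduced_product) : pi_group G :=
  repr (x : quotg rp_congr).

End ReducedProduct.

Section PowQuot.
Variables (I : Type) (J : ideal I).

Definition pow_rel : rel (set I) := fun A B => `[< J (A `+` B) >].

Lemma pow_rel_equiv : equiv_class_of pow_rel.
Proof.
split=> [A|A B|B A C].
- by apply/asboolP; rewrite setYK; exact: ideal0.
- by rewrite /pow_rel setYC.
- move=> /asboolP AB /asboolP BC; apply/asboolP.
  apply: idealS (idealU AB BC) => i /= [[Ai nCi]|[Ci nAi]].
    by have [Bi|nBi] := EM (B i); [right; left|left; left].
  by have [Bi|nBi] := EM (B i); [left; right|right; right].
Qed.

Definition pow_equiv : equiv_rel (set I) := EquivRelPack pow_rel_equiv.

Definition powq : Type := {eq_quot pow_equiv}.
HB.instance Definition _ := Choice.on powq.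
HB.instance Definition _ := EqQuotient.on powq.

Lemma powqP (A B : set I) : \pi_powq A = \pi_powq B <-> J (A `+` B).
Proof.
split=> [/eqP|JAB].
  by rewrite eqmodE => /asboolP.
by apply/eqP; rewrite eqmodE; apply/asboolP.
Qed.

Definition powq_join (x y : powq) : powq := \pi_powq (repr x `|` repr y).
Definition powq_meet (x y : powq) : powq := \pi_powq (repr x `&` repr y).
Definition powq_compl (x : powq) : powq := \pi_powq (~` repr x).

Lemma pow_repr (A : set I) : J (repr (\pi_powq A) `+` A).
Proof. by apply/powqP; rewrite reprK. Qed.

Lemma powq_pi_join A B : powq_join (\pi_powq A) (\pi_powq B) = \pi_powq (A `|` B).
Proof.
apply/powqP; apply: idealS (idealU (pow_repr A) (pow_repr B)) => i.
rewrite /setY /setD /setU /=; move: (repr _ i) (repr _ i) => P Q; tauto.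
Qed.

Lemma powq_pi_meet A B : powq_meet (\pi_powq A) (\pi_powq B) = \pi_powq (A `&` B).
Proof.
apply/powqP; apply: idealS (idealU (pow_repr A) (pow_repr B)) => i.
rewrite /setY /setD /setU /setI /=; move: (repr _ i) (repr _ i) => P Q.
have := EM (A i); have := EM (B i); have := EM P; have := EM Q; tauto.
Qed.

Lemma powq_pi_compl A : powq_compl (\pi_powq A) = \pi_powq (~` A).
Proof.
apply/powqP; apply: idealS (pow_repr A) => i.
rewrite /setY /setD /setU /setC /=; move: (repr _ i) => P.
have := EM (A i); have := EM P; tauto.
Qed.

Definition powq_le (x y : powq) : bool := powq_meet x y == x.
Definition powq_lt (x y : powq) : bool := (y != x) && powq_le x y.

Lemma powq_meetC : commutative powq_meet.
Proof. by move=> x y; rewrite /powq_meet setIC. Qed.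
Lemma powq_joinC : commutative powq_join.
Proof. by move=> x y; rewrite /powq_join setUC. Qed.
Lemma powq_meetA : associative powq_meet.
Proof.
elim/quotW=> x; elim/quotW=> y; elim/quotW=> z.
by rewrite (powq_pi_meet y) (powq_pi_meet x y) !powq_pi_meet setIA.
Qed.
Lemma powq_joinA : associative powq_join.
Proof.
elim/quotW=> x; elim/quotW=> y; elim/quotW=> z.
by rewrite (powq_pi_join y) (powq_pi_join x y) !powq_pi_join setUA.
Qed.
Lemma powq_joinKI y x : powq_meet x (powq_join x y) = x.
Proof.
rewrite -[x]reprK -[y]reprK powq_pi_join powq_pi_meet.
by rewrite setUC setKU.
Qed.
Lemma powq_meetKU y x : powq_join x (powq_meet x y) = x.
Proof.
rewrite -[x]reprK -[y]reprK powq_pi_meet powq_pi_join.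
by rewrite setIC setKI.
Qed.
Lemma powq_meetUl : left_distributive powq_meet powq_join.
Proof.
elim/quotW=> x; elim/quotW=> y; elim/quotW=> z.
by rewrite (powq_pi_join x y) (powq_pi_meet x z) (powq_pi_meet y z) powq_pi_meet
  powq_pi_join setIUl.
Qed.
Lemma powq_meetxx : idempotent_op powq_meet.
Proof. by move=> x; rewrite /powq_meet setIid reprK. Qed.

Fact powq_display : Order.disp_t. Proof. exact: Order.Disp tt tt. Qed.

HB.instance Definition _ := Order.isMeetJoinDistrLattice.Build
  powq_display powq (fun _ _ => erefl) (fun _ _ => erefl)
  powq_meetC powq_joinC powq_meetA powq_joinA powq_joinKI powq_meetKU
  powq_meetUl powq_meetxx.

Lemma powq_le0 (x : powq) : (\pi_powq set0 <= x)%O.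
Proof.
by rewrite /Order.le /= /powq_le -[x]reprK powq_pi_meet set0I.
Qed.
Lemma powq_leT (x : powq) : (x <= \pi_powq setT)%O.
Proof.
by rewrite /Order.le /= /powq_le -[x]reprK powq_pi_meet setIT.
Qed.

HB.instance Definition _ := Order.hasBottom.Build powq_display powq powq_le0.
HB.instance Definition _ := Order.hasTop.Build powq_display powq powq_leT.

Lemma powq_joinxC (x : powq) : Order.join x (powq_compl x) = Order.top.
Proof.
rewrite /Order.join /= -[x]reprK powq_pi_compl powq_pi_join.
by rewrite setUv.
Qed.
Lemma powq_meetxC (x : powq) : Order.meet x (powq_compl x) = Order.bottom.
Proof.
rewrite /Order.meet /= -[x]reprK powq_pi_compl powq_pi_meet.
by rewrite setICr.
Qed.

HB.instance Definition _ := Order.TBDistrLattice_hasComplement.Build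
  powq_display powq powq_joinxC powq_meetxC.

Lemma powqE :
  [/\ forall A B, \pi_powq (A `|` B) = Order.join (\pi_powq A) (\pi_powq B),
      forall A B, \pi_powq (A `&` B) = Order.meet (\pi_powq A) (\pi_powq B),
      forall A, \pi_powq (~` A) = Order.compl (\pi_powq A),
      \pi_powq set0 = Order.bottom & \pi_powq setT = Order.top].
Proof.
split=> // [A B|A B|A].
- by rewrite -powq_pi_join.
- by rewrite -powq_pi_meet.
- by rewrite -powq_pi_compl.
Qed.

End PowQuot.

Definition boolean_iso (d d' : Order.disp_t) (A : ctbDistrLatticeType d)
    (B : ctbDistrLatticeType d') (f : A -> B) : Prop :=
  [/\ bijective f,
      forall x y, f (Order.join x y) = Order.join (f x) (f y),
      forall x y, f (Order.meet x y) = Order.meet (f x) (f y)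
    & forall x, f (Order.compl x) = Order.compl (f x)].

Section Restriction.
Variables (I : Type) (J : ideal I) (G : I -> groupType).

Section RestrictedIdeal.
Variable A : set I.
Definition restr_ideal_set : set (set (set_type A)) :=
  [set B | J ((fun i : set_type A => val i) @` B)].

Lemma restr_ideal0 : restr_ideal_set set0.
Proof. by rewrite /restr_ideal_set /= image_set0; exact: ideal0. Qed.
Lemma restr_idealU B C : restr_ideal_set B -> restr_ideal_set C ->
  restr_ideal_set (B `|` C).
Proof. by rewrite /restr_ideal_set /= image_setU; exact: idealU. Qed.
Lemma restr_idealS B C : B `<=` C -> restr_ideal_set C -> restr_ideal_set B.
Proof. by move=> BC; apply: idealS; exact: image_subset. Qed.

Definition restr_ideal : ideal (set_type A) :=
  Ideal restr_ideal0 restr_idealU restr_idealS.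
End RestrictedIdeal.

Definition rp_restr (S : powq J) : groupType :=
  reduced_product (restr_ideal (repr S))
    (fun i : set_type (repr S) => G (val i)).

Definition rp_pi (S : powq J) (x : reduced_product J G) : rp_restr S :=
  rp_class (restr_ideal (repr S))
    ((fun i => rp_repr x (val i))
      : pi_group (fun i : set_type (repr S) => G (val i))).

(* [rp_pi] does not depend on the representative of [x], and two elements have
   the same image iff they agree on [A] up to a member of [J], whatever the
   representative [A] of [S]. *)
Lemma rp_piP (A : set I) (a b : pi_group G) :
  rp_pi (\pi_(powq J) A) (rp_class J a) = rp_pi (\pi_(powq J) A) (rp_class J b)
  <-> J [set i | A i /\ a i <> b i].
Proof.
set S := \pi_(powq J) A.
have JS : J (repr S `+` A) := pow_repr J A.
have ra : J [set i | rp_repr (rp_class J a) i <> a i] := gc_repr (rp_congr J G) a.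
have rb : J [set i | rp_repr (rp_class J b) i <> b i] := gc_repr (rp_congr J G) b.
rewrite /rp_pi; move: (rp_repr _) (rp_repr _) ra rb => b' a' ra rb.
rewrite /rp_class quotgP /= /rp_rel /= /restr_ideal_set /=; split.
- move=> H; apply: idealS (idealU (idealU H JS) (idealU ra rb)) => i /= [Ai nab].
  have [Si|nSi] := EM (repr S i); last by left; right; right.
  have [aa|naa] := EM (a' i = a i); last by right; left.
  have [bb|nbb] := EM (b' i = b i); last by right; right.
  left; left; exists (SigSub (mem_set Si)) => //=.
  by rewrite aa bb.
- move=> H; apply: idealS (idealU (idealU H JS) (idealU ra rb)) => _ /= [[i Si]] /= nab <-.
  move: (set_mem Si) => {}Si.
  have [Ai|nAi] := EM (A i); last by left; right; left.
  have [aa|naa] := EM (a' i = a i); last by right; left.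
  have [bb|nbb] := EM (b' i = b i); last by right; right.
  by left; left; split => // ab; apply: nab; rewrite aa bb.
Qed.

End Restriction.

Definition group_iso (G H : groupType) (f : G -> H) : Prop :=
  bijective f /\ forall x y, f (x * y) = f x * f y.

Definition coordinate_respecting (I I' : Type) (J : ideal I) (J' : ideal I')
    (G : I -> groupType) (H : I' -> groupType)
    (Phi : reduced_product J G -> reduced_product J' H) : Prop :=
  exists2 alpha : powq J -> powq J', boolean_iso alpha &
    forall (S : powq J) (a b : reduced_product J G),
      rp_pi S a = rp_pi S b ->
      rp_pi (alpha S) (Phi a) = rp_pi (alpha S) (Phi b).

Definition recognizes_coordinates (C : groupType -> Prop) : Prop :=
  forall (I I' : Type) (J : ideal I) (J' : ideal I')
    (G : I -> groupType) (H : I' -> groupType),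
    proper_ideal J -> proper_ideal J' ->
    (forall i, C (G i)) -> (forall j, C (H j)) ->
    forall Phi : reduced_product J G -> reduced_product J' H,
      group_iso Phi -> coordinate_respecting Phi.

Definition group_recognizes_coordinates (K : groupType) : Prop :=
  recognizes_coordinates (fun K' => K' = K).

(* A class of groups is read up to isomorphism. *)
Definition connected_graph_products (K : groupType) : Prop :=
  exists (V : Type) (Gamma : graph V) (G : V -> groupType),
    [/\ gp_nontrivial G,
        graph_connected (complement Gamma),
        exists v, card_at_least 3 (G v)
      & exists f : graph_product Gamma G -> K, group_iso f].

(* Main.v *)
Require Import Defs.
From Stdlib Require Import Relation_Operators List.
From HB Require Import structures.
From mathcomp Require Import all_boot all_order.
From mathcomp Require Import monoid generic_quotient.
From mathcomp Require Import boolp classical_sets.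
Set Implicit Arguments.
Unset Strict Implicit.
Unset Printing Implicit Defensive.

(* If any two nontrivial elements x, y of every factor admit a z such that x
   does not commute with z y z^-1, then two elements of a reduced product have
   disjoint supports iff each commutes with all conjugates of the other. So
   every isomorphism preserves disjointness of supports, hence the Boolean
   algebra of supports.

   This property holds in a graph product K with connected complement. For a
   vertex u with link L, K is the amalgam A *_C B with A generated by the
   G_v, v <> u, C generated by the G_v, v in L, and B = G_u x C. That the type
   of the first syllable of an alternating product is well defined is seen on
   the action of K = ( *_{A/C} G_u) >| A on the reduced words of the free
   product. If |G_u| >= 3, then an element outside C is conjugate to an
   alternating product with both ends in B, and also to one with both ends in
   A, and products of these two kinds do not commute. Finally, no nontrivial
   element x has all its conjugates in C: they would lie in the analogous
   subgroup of every vertex, by propagation along the edges of the complement,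
   whereas a word for x involves some vertex.

   If the complement is disconnected, K is a product K1 x K2 of nontrivial
   groups and exchanging the two K2-components of K x K does not respect
   coordinates. *)

Import Order.Theory.
Local Open Scope group_scope.
Local Open Scope quotient_scope.
Local Open Scope classical_set_scope.

(** * Graph products: universal property and retractions *)

Section UniversalProperty.
Variables (V : Type) (Gamma : graph V) (G : V -> groupType).
Local Notation K := (graph_product Gamma G).
Local Notation gp_congr :=
  (normal_congr (normal_closure_normal (@gp_relators V Gamma G))).

Definition gp_in (v : V) (a : G v) : K := \pi_(quotg gp_congr) (fp_in a).

Lemma gp_inM v (a b : G v) : gp_in (a * b) = gp_in a * gp_in b.
Proof. by rewrite /gp_in fp_inM (quotg_piM gp_congr). Qed.

Lemma fp_in1 v : fp_in (1 : G v) = 1.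
Proof. by apply/(@quotgP _ (word_congr G)); exact: word_eq1. Qed.

Lemma gp_in1 v : gp_in (1 : G v) = 1.
Proof. by rewrite /gp_in fp_in1. Qed.

Lemma gp_in_comm v w (a : G v) (b : G w) : Gamma v w ->
  gp_in a * gp_in b = gp_in b * gp_in a.
Proof.
move=> vw; rewrite /gp_in -!(quotg_piM gp_congr).
apply/(@quotgP _ gp_congr) => N nN; apply.
by exists v, w, a, b; rewrite invgM !mulgA.
Qed.

(** Inverses of generators are again generators, so it suffices to peel letters off a word from the
    left. *)
Lemma gp_ind (P : K -> Prop) : P 1 ->
  (forall v (a : G v) x, P x -> P (gp_in a * x)) -> forall x, P x.
Proof.
move=> P1 PM; elim/(@quotW _ (quotg gp_congr)).
elim/(@quotW _ (quotg (word_congr G))); elim=> [//|[v a] s IHs].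
have -> : (lett a :: s : word G) = ([:: lett a] : word G) * s by [].
rewrite (quotg_piM (word_congr G)) (quotg_piM gp_congr).
exact: PM.
Qed.

Section Extension.
Variables (M : monoidType) (f : forall v, G v -> M).
Arguments f {v}.

(** The target is only a monoid, so that the action built below can land in self-maps without
    exhibiting inverses. *)
Definition word_ext (s : word G) : M :=
  foldr (fun l m => f (projT2 l) * m) 1 s.
Definition fp_ext (x : free_product G) : M :=
  word_ext (repr (x : quotg (word_congr G))).
Definition gp_ext (x : K) : M := fp_ext (repr (x : quotg gp_congr)).

Hypothesis f1 : forall v, f (1 : G v) = 1.
Hypothesis fM : forall v (a b : G v), f (a * b) = f a * f b.
Hypothesis fC : forall v w (a : G v) (b : G w), Gamma v w ->
  f a * f b = f b * f a.

Lemma word_ext_cat s t : word_ext (s ++ t) = word_ext s * word_ext t.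
Proof. by elim: s => [|l s IHs] /=; rewrite ?mul1g // IHs mulgA. Qed.

Lemma word_ext_eq s t : word_eq s t -> word_ext s = word_ext t.
Proof.
elim=> {s t} //= [v|v a b|s t u _ -> _ ->//|s s' t t' _ es _ et].
- by rewrite f1 mulg1.
- by rewrite fM mulgA.
- by rewrite !word_ext_cat es et.
Qed.

Lemma fp_ext_pi s : fp_ext (\pi_(quotg (word_congr G)) s) = word_ext s.
Proof. exact: word_ext_eq (gc_repr (word_congr G) s). Qed.

Lemma fp_extM : {morph fp_ext : x y / x * y}.
Proof.
elim/(@quotW _ (quotg (word_congr G))) => s.
elim/(@quotW _ (quotg (word_congr G))) => t.
by rewrite -(quotg_piM (word_congr G)) !fp_ext_pi word_ext_cat.
Qed.

Lemma fp_ext1 : fp_ext 1 = 1.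
Proof. exact: fp_ext_pi [::]. Qed.

Lemma fp_ext_in v (a : G v) : fp_ext (fp_in a) = f a.
Proof. by rewrite fp_ext_pi /= mulg1. Qed.

Lemma fp_extV x : fp_ext x^-1 * fp_ext x = 1.
Proof. by rewrite -fp_extM mulVg fp_ext1. Qed.

Lemma fp_ext_ker_normal : normal_subgroup [set x | fp_ext x = 1].
Proof.
split=> /= [|x y fx fy|x fx|x y fx]; first exact: fp_ext1.
- by rewrite fp_extM fx fy mulg1.
- by have := fp_extV x; rewrite fx mulg1.
- by rewrite !fp_extM fx mulg1 -fp_extM mulgV fp_ext1.
Qed.

Lemma fp_ext_eq x y : gp_congr x y -> fp_ext x = fp_ext y.
Proof.
move=> xy; suff: fp_ext (x * y^-1) = 1.
  by move=> e; rewrite -[x](mulgVK y) fp_extM e mul1g.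
(* The normal closure is an intersection, so it is enough that the relators lie in this kernel.
   There [fC] swaps the factors in [M], and the cancellation then takes place in the free product,
   where inverses exist. *)
apply: (xy _ fp_ext_ker_normal) => _ [v [w [a [b [vw ->]]]]] /=.
rewrite !fp_extM !fp_ext_in fC // -!fp_ext_in -!fp_extM.
by rewrite mulgK mulgV fp_ext1.
Qed.

Lemma gp_ext_pi x : gp_ext (\pi_(quotg gp_congr) x) = fp_ext x.
Proof. exact: fp_ext_eq (gc_repr gp_congr x). Qed.

Lemma gp_extM : {morph gp_ext : x y / x * y}.
Proof.
elim/(@quotW _ (quotg gp_congr)) => x; elim/(@quotW _ (quotg gp_congr)) => y.
by rewrite -(quotg_piM gp_congr) !gp_ext_pi fp_extM.
Qed.

Lemma gp_ext1 : gp_ext 1 = 1.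
Proof. by rewrite -fp_ext1; exact: gp_ext_pi 1. Qed.

Lemma gp_ext_in v (a : G v) : gp_ext (gp_in a) = f a.
Proof. by rewrite gp_ext_pi fp_ext_in. Qed.

End Extension.
End UniversalProperty.
Arguments gp_in {V} Gamma {G v} a.

(** * Retractions onto subgroups generated by vertex groups *)

Section Retraction.
Variables (V : Type) (Gamma : graph V) (G : V -> groupType).
Local Notation K := (graph_product Gamma G).
Local Notation gp_in := (gp_in Gamma).
Implicit Types (S T : set V) (x y : K).

(** The subgroup generated by the [G v] with [v] in [S] is handled as the set of fixed points of
    [retr S]; intersections of such subgroups then become compositions of retractions. *)
Definition retr_in S v (a : G v) : K := if `[< S v >] then gp_in a else 1.
Definition retr S : K -> K := gp_ext (retr_in S).

Lemma retr_in1 S v : retr_in S (1 : G v) = 1.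
Proof. by rewrite /retr_in gp_in1; case: ifP. Qed.

Lemma retr_inM S v (a b : G v) : retr_in S (a * b) = retr_in S a * retr_in S b.
Proof. by rewrite /retr_in; case: ifP => _; rewrite ?mulg1 ?gp_inM. Qed.

Lemma retr_in_comm S v w (a : G v) (b : G w) : Gamma v w ->
  retr_in S a * retr_in S b = retr_in S b * retr_in S a.
Proof.
move=> vw; rewrite /retr_in.
by case: ifP => _; case: ifP => _; rewrite ?mulg1 ?mul1g //; exact: gp_in_comm.
Qed.

Lemma retrM S : {morph retr S : x y / x * y}.
Proof.
by apply: gp_extM; [exact: retr_in1|exact: retr_inM|exact: retr_in_comm].
Qed.

Lemma retr1 S : retr S 1 = 1.
Proof.
by apply: gp_ext1; [exact: retr_in1|exact: retr_inM|exact: retr_in_comm].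
Qed.

Lemma retrV S : {morph retr S : x / x^-1}.
Proof.
by move=> x; apply: (mulgI (retr S x)); rewrite -retrM !mulgV retr1.
Qed.

Lemma retr_gp_in S v (a : G v) : retr S (gp_in a) = retr_in S a.
Proof.
by apply: gp_ext_in; [exact: retr_in1|exact: retr_inM|exact: retr_in_comm].
Qed.

Lemma retr_id S v (a : G v) : S v -> retr S (gp_in a) = gp_in a.
Proof. by move=> Sv; rewrite retr_gp_in /retr_in asboolT. Qed.

Lemma retr_triv S v (a : G v) : ~ S v -> retr S (gp_in a) = 1.
Proof. by move=> Sv; rewrite retr_gp_in /retr_in asboolF. Qed.

Lemma retr_comp S T x : retr S (retr T x) = retr (S `&` T) x.
Proof.
elim/gp_ind: x => [|v a x IHx]; first by rewrite !retr1.
rewrite !retrM IHx; congr (_ * _).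
have [Tv|nTv] := EM (T v); last first.
  by rewrite (retr_triv _ nTv) retr1 retr_triv // => -[].
rewrite (retr_id _ Tv); have [Sv|nSv] := EM (S v).
  by rewrite !retr_id.
by rewrite !retr_triv // => -[].
Qed.

Lemma retr_fixS S T x : S `<=` T -> retr S x = x -> retr T x = x.
Proof. by move=> ST <-; rewrite retr_comp; congr (retr _ x); apply/setIidr. Qed.

Lemma retr_fixI S T x : retr S x = x -> retr T x = x -> retr (S `&` T) x = x.
Proof. by move=> Sx Tx; rewrite -retr_comp Tx. Qed.

Lemma retr_setT x : retr setT x = x.
Proof.
by elim/gp_ind: x => [|v a x IHx]; rewrite ?retr1 // retrM IHx retr_id.
Qed.

Lemma retr_comm S T x y : (forall v w, S v -> T w -> Gamma v w) ->
  retr S x * retr T y = retr T y * retr S x.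
Proof.
move=> ST; elim/gp_ind: x => [|v a x IHx]; first by rewrite retr1 mulg1 mul1g.
rewrite retrM -mulgA IHx !mulgA; congr (_ * _).
have [Sv|nSv] := EM (S v); last by rewrite retr_triv // mulg1 mul1g.
rewrite (retr_id _ Sv); elim/gp_ind: y {IHx} => [|w b y IHy].
  by rewrite retr1 mulg1 mul1g.
rewrite retrM mulgA -[RHS]mulgA -IHy !mulgA; congr (_ * _).
have [Tw|nTw] := EM (T w); last by rewrite retr_triv // mulg1 mul1g.
by rewrite retr_id // gp_in_comm //; exact: ST.
Qed.

(** Words are finite even if [V] is not: [l] lists the vertices of a word for [x]. *)
Lemma retr_finite x : exists l : seq V,
  forall S, (forall v, In v l -> ~ S v) -> retr S x = 1.
Proof.
elim/gp_ind: x => [|v a x [l lP]]; first by exists [::] => S _; exact: retr1.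
exists (v :: l) => S Sl; rewrite retrM retr_triv ?lP ?mulg1 //.
  by move=> w lw; apply: Sl; right.
by apply: Sl; left.
Qed.

(** Iterating [retr_fixI] reaches finite intersections only; the list of [retr_finite] makes these
    sufficient. *)
Lemma retr_fix_bigcap (P : V -> set V) x l :
  (forall v, retr (P v) x = x) ->
  retr [set w | forall v, In v l -> P v w] x = x.
Proof.
move=> Px; elim: l => [|v l IHl].
  by apply: retr_fixS (retr_setT x) => w _ v [].
apply: retr_fixS (retr_fixI (Px v) IHl) => w [Pvw Pl] u [<-//|]; exact: Pl.
Qed.

End Retraction.
Arguments retr_id {V Gamma G S v} a.
Arguments retr_triv {V Gamma G S v} a.

(** * Alternating products in amalgams *)

Definition conj_commuting (K : groupType) (x y : K) : Prop :=
  forall z, x * (z * y * z^-1) = (z * y * z^-1) * x.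

Definition conj_noncommuting (K : groupType) : Prop :=
  forall x y : K, x <> 1 -> y <> 1 ->
  exists z, x * (z * y * z^-1) <> (z * y * z^-1) * x.

(** Conjugating by [p^-1] turns the given pair into [x] and a conjugate of [y], so both elements may
    first be replaced by convenient conjugates. *)
Lemma noncommuting_conj (K : groupType) (p q x y z : K) :
  (p * x * p^-1) * (z * (q * y * q^-1) * z^-1) <>
    (z * (q * y * q^-1) * z^-1) * (p * x * p^-1) ->
  exists z, x * (z * y * z^-1) <> (z * y * z^-1) * x.
Proof.
move=> nxy; exists (p^-1 * z * q) => xy; apply: nxy.
have := congr1 (fun t => p * t * p^-1) xy.
by rewrite !invgM !invgK !mulgA !(mulgK, mulgVK, mulgV, mul1g).
Qed.

(* [S false] and [S true] are the factors A and B of an amalgam A *_C B, with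
   C = [core]. *)
Section Amalgam.
Variables (K : groupType) (S : bool -> set K).
Implicit Types (b c : bool) (x y z : K).

Definition syllable b x := S b x /\ ~ S (~~ b) x.

(** The two indices are the factors of the first and of the last syllable; a syllable lies in one
    factor and outside C. *)
Inductive alternating : bool -> bool -> K -> Prop :=
| alternating1 b x : syllable b x -> alternating b b x
| alternating_cons b c x y :
    syllable b x -> alternating (~~ b) c y -> alternating b c (x * y).

Hypothesis S1 : forall b, S b 1.
Hypothesis SM : forall b x y, S b x -> S b y -> S b (x * y).
Hypothesis SV : forall b x, S b x -> S b x^-1.
Hypothesis S_gen : forall P : K -> Prop, P 1 ->
  (forall b x y, S b x -> P y -> P (x * y)) -> forall x, P x.

Local Definition core x := forall b, S b x.

Lemma S_core_or_syllable b x : S b x -> core x \/ syllable b x.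
Proof.
move=> Sx; have [S'x|] := EM (S (~~ b) x); last by right.
by left=> c; case: b c Sx S'x => -[].
Qed.

Lemma S_mulI b x y : S b x -> S b (x * y) -> S b y.
Proof. by move=> /SV Sx Sxy; rewrite -(mulKg x y); exact: SM. Qed.

Lemma S_mulIr b x y : S b y -> S b (x * y) -> S b x.
Proof. by move=> /SV Sy Sxy; rewrite -(mulgK y x); exact: SM. Qed.

Lemma syllableV b x : syllable b x -> syllable b x^-1.
Proof.
by move=> [Sx S'x]; split; [exact: SV|move=> /SV; rewrite invgK].
Qed.

Lemma core_syllable b x y : core x -> syllable b y -> syllable b (x * y).
Proof.
by move=> Cx [Sy S'y]; split; [exact: SM|move=> /(S_mulI (Cx _))].
Qed.

Lemma core_alternating b c x y :
  core x -> alternating b c y -> alternating b c (x * y).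
Proof.
move=> Cx [b' z zl|b' c' z z' zl z'a].
  exact/alternating1/core_syllable.
by rewrite mulgA; apply: alternating_cons => //; exact: core_syllable.
Qed.

(** A new factor element is prepended, or merged with a first syllable of the same factor; whatever
    falls into C is absorbed by the neighbouring syllable. *)
Lemma core_or_alternating x : core x \/ exists b c, alternating b c x.
Proof.
elim/S_gen: x => [|b x y Sx]; first by left.
have [Cx|xl] := S_core_or_syllable Sx.
  case=> [Cy|[b' [c ya]]]; first by left=> b'; exact: SM.
  by right; exists b', c; exact: core_alternating.
case=> [Cy|[b' [c ya]]].
  right; exists b, b; apply: alternating1; split; first exact: SM.
  by move=> /(S_mulIr (Cy _)); exact: xl.2.
have [eb|] := eqVneq b' b; last first.
  move=> nb; right; exists b, c; apply: alternating_cons => //.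
  by case: b b' nb {Sx xl} ya => -[].
case: ya eb => [b0 z [Sz _]|b0 c0 z t [Sz _] ta] eb; subst b0.
  have [|xzl] := S_core_or_syllable (SM Sx Sz); first by left.
  by right; exists b, b; exact: alternating1.
rewrite mulgA; have [Cxy|xyl] := S_core_or_syllable (SM Sx Sz).
  by right; exists (~~ b), c0; exact: core_alternating.
by right; exists b, c0; exact: alternating_cons.
Qed.

Lemma alternating_cat b c d x y :
  alternating b c x -> alternating (~~ c) d y -> alternating b d (x * y).
Proof.
move=> xa; elim: xa d y => {b c x} [b x xl d y ya|b c x z xl _ IH d y ya].
  exact: alternating_cons.
by rewrite -mulgA; apply: alternating_cons => //; exact: IH.
Qed.

Lemma alternating_cons_inv b c x : alternating b c x ->
  (b = c /\ syllable b x) \/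
  exists y z, [/\ x = y * z, syllable b y & alternating (~~ b) c z].
Proof. by case=> [{}b {}x xl|{}b {}c y z yl za]; [left|right; exists y, z]. Qed.

Lemma alternating_rcons_inv b c x : alternating b c x ->
  (b = c /\ syllable c x) \/
  exists y z, [/\ x = y * z, alternating b (~~ c) y & syllable c z].
Proof.
elim=> {b c x} [b x xl|b c x y xl ya IH]; first by left.
right; case: IH => [[<- yl]|[z [t [-> za tl]]]].
  by exists x, y; split=> //; rewrite negbK; exact: alternating1.
by exists (x * z), t; split; rewrite ?mulgA //; exact: alternating_cons.
Qed.

Section Centralisers.
Variables (alpha beta1 beta2 : K).
Hypothesis alphaP : syllable false alpha.
Hypotheses (beta1P : syllable true beta1) (beta2P : syllable true beta2).
Hypothesis beta12 : ~ S false (beta1 * beta2^-1).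

(** If both [beta1 * x] and [beta2 * x] were in A, so would be their quotient [beta1 * beta2^-1]. *)
Lemma beta_choice_l x : syllable true x ->
  exists2 y, syllable true y & syllable true (y * x).
Proof.
move=> [Sx _]; have [Sx1|n1] := EM (S false (beta1 * x)); last first.
  by exists beta1 => //; split=> //; apply: SM => //; case: beta1P.
exists beta2 => //; split=> [|Sx2]; first by apply: SM => //; case: beta2P.
by apply: beta12; have := SM Sx1 (SV Sx2); rewrite invgM mulgA mulgK.
Qed.

Lemma beta_choice_r x : syllable true x ->
  exists2 y, syllable true y & syllable true (x * y^-1).
Proof.
move=> /syllableV /beta_choice_l [y yl /syllableV]; rewrite invgM invgK.
by exists y.
Qed.

(** If exactly one end is in B, the conjugator must not cancel the syllable there into C; one of
    [beta1], [beta2] is safe. At an end in A any syllable of B can be attached. *)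
Lemma conj_alternating_true x : ~ core x ->
  exists y, alternating true true (y * x * y^-1).
Proof.
have conj y z : syllable true y -> alternating false false z ->
    alternating true true (y * z * y^-1).
  move=> yl za; rewrite -mulgA; apply: alternating_cons => //.
  by apply: alternating_cat za _; exact/alternating1/syllableV.
move=> nCx; have [//|[b [c xa]]] := core_or_alternating x.
case: b c xa => -[] xa.
- by exists 1; rewrite invg1 mulg1 mul1g.
- have [[]//|[y [z [-> yl za]]]] := alternating_cons_inv xa.
  have [t tl tyl] := beta_choice_l yl; exists t.
  rewrite (mulgA t) -(mulgA (t * y)); apply: alternating_cons => //.
  by apply: alternating_cat za _; exact/alternating1/syllableV.
- have [[]//|[y [z [-> ya zl]]]] := alternating_rcons_inv xa.
  have [t tl ztl] := beta_choice_r zl; exists t.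
  rewrite -!mulgA; apply: alternating_cons => //.
  by apply: alternating_cat ya _; exact/alternating1.
- by exists beta1; exact: conj.
Qed.

Lemma conj_alternating_false x : ~ core x ->
  exists y, alternating false false (y * x * y^-1).
Proof.
move=> /conj_alternating_true [y ya]; exists (alpha * y).
rewrite invgM !mulgA -2!(mulgA alpha) -mulgA; apply: alternating_cons => //.
by apply: alternating_cat ya _; exact/alternating1/syllableV.
Qed.

Variable head : K -> bool.
Hypothesis head_syllable : forall b x, syllable b x -> head x = b.
Hypothesis head_cons : forall b x y, syllable b x -> head y = ~~ b ->
  head (x * y) = b.

(** [head] stands in for the normal form theorem: the first factor depends on the element only, not
    on its factorization. *)
Lemma alternating_head b c x : alternating b c x -> head x = b.
Proof.
by elim=> {b c x} [b x|b c x y xl _]; [exact: head_syllable|exact: head_cons].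
Qed.

Lemma alternating_nocomm x y :
  alternating true true x -> alternating false false y -> x * y <> y * x.
Proof.
move=> xa ya xy; have := alternating_head (alternating_cat xa ya).
by rewrite xy (alternating_head (alternating_cat ya xa)).
Qed.

Lemma not_core_nocomm x y : ~ core x -> ~ core y ->
  exists z, x * (z * y * z^-1) <> (z * y * z^-1) * x.
Proof.
move=> /conj_alternating_true [p pa] /conj_alternating_false [q qa].
apply: (@noncommuting_conj _ p q x y 1); rewrite invg1 mulg1 mul1g.
exact: alternating_nocomm.
Qed.

End Centralisers.
End Amalgam.

(** * The amalgam decomposition at a vertex *)

Section Endo.
Variable T : choiceType.

Definition endo : Type := T -> T.
HB.instance Definition _ := Choice.on endo.
HB.instance Definition _ := @isMonoid.Build endo (fun f g => f \o g) id
  (fun _ _ _ => erefl) (fun _ => erefl) (fun _ => erefl).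

Lemma endoM (f g : endo) x : (f * g) x = f (g x). Proof. by []. Qed.

End Endo.

Section VertexAction.
Variables (V : Type) (Gamma : graph V) (G : V -> groupType) (u : V).
Local Notation K := (graph_product Gamma G).
Local Notation gp_in := (gp_in Gamma).
Local Notation link := [set v | Gamma u v].
Local Notation rest := [set v | v <> u].

Lemma link_rest : link `<=` rest.
Proof. by move=> v uv vu; rewrite vu in uv; exact: adj_irrefl uv. Qed.

Definition link_group : set K := [set x | retr link x = x].

Lemma link_group1 : link_group 1. Proof. exact: retr1. Qed.
Lemma link_groupM x y : link_group x -> link_group y -> link_group (x * y).
Proof. by rewrite /link_group /= retrM => -> ->. Qed.
Lemma link_groupV x : link_group x -> link_group x^-1.
Proof. by rewrite /link_group /= retrV => ->. Qed.

(** The left translate xA; cosets of C are represented as subsets of [K]. *)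
Definition shift (x : K) (A : set K) : set K := [set y | A (x^-1 * y)].

Lemma shift1 A : shift 1 A = A.
Proof. by rewrite /shift invg1; apply/seteqP; split=> y /=; rewrite mul1g. Qed.

Lemma shiftM x y A : shift (x * y) A = shift x (shift y A).
Proof. by rewrite /shift /= invgM; apply/seteqP; split=> z /=;
  rewrite mulgA. Qed.

Lemma shift_inj x : injective (shift x).
Proof.
by move=> A B /(congr1 (shift x^-1)); rewrite -!shiftM mulVg !shift1.
Qed.

Lemma shift_link_group x : (shift x link_group = link_group) <-> link_group x.
Proof.
split=> [xC|Cx].
  by rewrite -xC /shift /= mulVg; exact: link_group1.
apply/seteqP; split=> y; rewrite /shift /= => Cy; last first.
  by apply: link_groupM => //; exact: link_groupV.
by rewrite -(mulVKg x y); exact: link_groupM.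
Qed.

(* Reduced words in the free product of copies of [G u] indexed by the left
   translates of [link_group]. *)
Local Notation coset_word := (seq (set K * G u)).

Definition head_is (A : set K) (s : coset_word) : bool :=
  if s is (B, _) :: _ then B == A else false.

Fixpoint reduced (s : coset_word) : bool :=
  if s is (A, g) :: t then [&& g != 1, ~~ head_is A t & reduced t] else true.

(** Van der Waerden's device: a reduced word is split uniquely into its leading coefficient at the
    label C, by default 1, and a reduced word not starting with C. [G u] then multiplies the
    coefficient only. *)
Definition split_head (s : coset_word) : G u * coset_word :=
  if s is (A, g) :: t then if A == link_group then (g, t) else (1, s)
  else (1, s).

Definition cons_head (g : G u) (s : coset_word) : coset_word :=
  if g == 1 then s else (link_group, g) :: s.

Definition mul_head (g : G u) (s : coset_word) : coset_word :=
  cons_head (g * (split_head s).1) (split_head s).2.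

Definition shift_word (x : K) (s : coset_word) : coset_word :=
  [seq (shift x p.1, p.2) | p <- s].

Lemma split_headP s : reduced s ->
  [/\ s = cons_head (split_head s).1 (split_head s).2,
      ~~ head_is link_group (split_head s).2 & reduced (split_head s).2].
Proof.
case: s => [|[A g] t] /=; first by rewrite /cons_head eqxx.
case: (eqVneq A link_group) => [->|nA] /and3P[g1 At rt] /=.
  by rewrite /cons_head (negPf g1).
by rewrite /cons_head eqxx /= (negPf nA) g1 At rt.
Qed.

Lemma split_cons_head g s : ~~ head_is link_group s ->
  split_head (cons_head g s) = (g, s).
Proof.
rewrite /cons_head; case: eqVneq => [->|_ _] /=; last by rewrite eqxx.
by case: s => [//|[A h] t] /= /negPf ->.
Qed.

Lemma reduced_cons_head g s : ~~ head_is link_group s -> reduced s ->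
  reduced (cons_head g s).
Proof. by rewrite /cons_head; case: eqVneq => //= g1 -> ->; rewrite g1. Qed.

Lemma reduced_mul_head g s : reduced s -> reduced (mul_head g s).
Proof. by move=> /split_headP[_ hs rs]; exact: reduced_cons_head. Qed.

Lemma mul_head1 s : reduced s -> mul_head 1 s = s.
Proof. by move=> /split_headP[es _ _]; rewrite /mul_head mul1g -es. Qed.

Lemma mul_headM g h s : reduced s ->
  mul_head (g * h) s = mul_head g (mul_head h s).
Proof.
move=> /split_headP[_ hs _].
by rewrite /mul_head split_cons_head //= mulgA.
Qed.

Lemma head_is_shift x A s : head_is (shift x A) (shift_word x s) = head_is A s.
Proof. by case: s => [//|[B g] s] /=; exact: inj_eq (@shift_inj x) _ _. Qed.

Lemma reduced_shift x s : reduced s -> reduced (shift_word x s).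
Proof.
elim: s => [//|[A g] s IHs] /= /and3P[-> As /IHs ->].
by rewrite andbT head_is_shift.
Qed.

Lemma shift_word1 s : shift_word 1 s = s.
Proof. by elim: s => [//|[A g] s IHs] /=; rewrite shift1 IHs. Qed.

Lemma shift_wordM x y s : shift_word (x * y) s = shift_word x (shift_word y s).
Proof. by elim: s => [//|[A g] s IHs] /=; rewrite shiftM IHs. Qed.

(** Translation by an element of C fixes the label C. This yields the relations between [G u] and
    the vertex groups in the link of [u]. *)
Lemma mul_head_shift g x s : link_group x ->
  mul_head g (shift_word x s) = shift_word x (mul_head g s).
Proof.
move=> /shift_link_group xC; rewrite /mul_head.
have -> : split_head (shift_word x s) =
    ((split_head s).1, shift_word x (split_head s).2).
  case: s => [//|[A h] s] /=; rewrite -{1}xC (inj_eq (@shift_inj x)).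
  by case: ifP.
by rewrite /cons_head /=; case: ifP => //= _; rewrite xC.
Qed.

Definition rword : Type := {s : coset_word | reduced s}.
HB.instance Definition _ := Choice.on rword.

Definition mul_act (g : G u) : endo rword :=
  fun s => exist (fun s => reduced s) _ (reduced_mul_head g (valP s)).
Definition shift_act (x : K) : endo rword :=
  fun s => exist (fun s => reduced s) _ (reduced_shift x (valP s)).

(** [G u] multiplies in the copy labelled C, and the other vertex groups translate the labels. *)
Definition vertex_act v (a : G v) : endo rword :=
  match pselect (v = u) with
  | left e => mul_act (eq_rect v (fun v => G v) a u e)
  | right _ => shift_act (gp_in a)
  end.

Lemma vertex_act_eq (a : G u) : vertex_act a = mul_act a.
Proof.
rewrite /vertex_act; case: pselect => // e.
by rewrite (Prop_irrelevance e (erefl u)).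
Qed.

Lemma vertex_act_neq v (a : G v) : v <> u -> vertex_act a = shift_act (gp_in a).
Proof. by rewrite /vertex_act; case: pselect. Qed.

Lemma shift_act1 : shift_act 1 = 1.
Proof. by apply/funext => s; apply: val_inj; exact: shift_word1. Qed.

Lemma shift_actM x y : shift_act (x * y) = shift_act x * shift_act y.
Proof. by apply/funext => s; apply: val_inj; exact: shift_wordM. Qed.

Lemma vertex_act1 v : vertex_act (1 : G v) = 1.
Proof.
have [->|vu] := EM (v = u); last by rewrite vertex_act_neq // gp_in1 shift_act1.
rewrite vertex_act_eq; apply/funext => s; apply: val_inj.
exact: mul_head1 (valP s).
Qed.

Lemma vertex_actM v (a b : G v) :
  vertex_act (a * b) = vertex_act a * vertex_act b.
Proof.
have [e|vu] := EM (v = u); last first.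
  by rewrite !vertex_act_neq // gp_inM shift_actM.
subst v; rewrite !vertex_act_eq; apply/funext => s; apply: val_inj.
exact: mul_headM (valP s).
Qed.

Lemma vertex_act_comm v w (a : G v) (b : G w) : Gamma v w ->
  vertex_act a * vertex_act b = vertex_act b * vertex_act a.
Proof.
have comm w' (g : G u) (c : G w') : Gamma u w' ->
    vertex_act g * vertex_act c = vertex_act c * vertex_act g.
  move=> uw; rewrite vertex_act_eq vertex_act_neq; last exact: link_rest.
  apply/funext => s; apply: val_inj; apply: mul_head_shift.
  by rewrite /link_group /= retr_id.
have [e|vu] := EM (v = u); first by subst v; exact: comm.
have [e|wu] := EM (w = u).
  by subst w => uv; apply/esym/comm/adj_sym.
by move=> vw; rewrite !vertex_act_neq // -!shift_actM gp_in_comm.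
Qed.

Definition gp_act : K -> endo rword := gp_ext vertex_act.

Lemma gp_actM : {morph gp_act : x y / x * y}.
Proof.
apply: gp_extM; [exact: vertex_act1|exact: vertex_actM|].
exact: vertex_act_comm.
Qed.

Lemma gp_act1 : gp_act 1 = 1.
Proof.
apply: gp_ext1; [exact: vertex_act1|exact: vertex_actM|].
exact: vertex_act_comm.
Qed.

Lemma gp_act_in v (a : G v) : gp_act (gp_in a) = vertex_act a.
Proof.
apply: gp_ext_in; [exact: vertex_act1|exact: vertex_actM|].
exact: vertex_act_comm.
Qed.

Lemma gp_act_rest x : retr rest x = x -> gp_act x = shift_act x.
Proof.
move=> <-; elim/gp_ind: x => [|v a x IHx];
  first by rewrite retr1 gp_act1 shift_act1.
rewrite retrM gp_actM shift_actM IHx; congr (_ * _).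
have [vu|vu] := EM (rest v); last by rewrite retr_triv // gp_act1 shift_act1.
by rewrite retr_id // gp_act_in vertex_act_neq.
Qed.

Definition nil_word : rword := exist (fun s => reduced s) [::] isT.

(** A nontrivial element of [G u] sends the empty word to a word with one letter. *)
Lemma gp_in_inj (a b : G u) : gp_in a = gp_in b -> a = b.
Proof.
move=> ab; apply/eqP; rewrite -divg_eq1; apply/eqP; set c := a / b.
have : gp_act (gp_in c) nil_word = nil_word.
  have -> : gp_in c = 1 by rewrite gp_inM ab -gp_inM mulgV gp_in1.
  by rewrite gp_act1.
rewrite gp_act_in vertex_act_eq => /(congr1 val) /=.
by rewrite /mul_head /cons_head /= mulg1; case: eqP.
Qed.

Definition vertex_factor (b : bool) : set K :=
  if b then [set x | exists (g : G u) y, link_group y /\ x = gp_in g * y]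
  else [set x | retr rest x = x].

Lemma link_group_rest x : link_group x -> retr rest x = x.
Proof. exact: retr_fixS link_rest. Qed.

Lemma link_group_factor x : link_group x -> vertex_factor true x.
Proof. by exists 1, x; rewrite gp_in1 mul1g. Qed.

Lemma link_group_comm (g : G u) x : link_group x -> x * gp_in g = gp_in g * x.
Proof.
move=> <-; rewrite -(@retr_id _ _ _ [set u] _ g) // [RHS]retr_comm //.
by move=> _ w ->.
Qed.

Lemma vertex_factor1 b : vertex_factor b 1.
Proof. by case: b; [exact/link_group_factor/link_group1|exact: retr1]. Qed.

Lemma vertex_factorM b x y :
  vertex_factor b x -> vertex_factor b y -> vertex_factor b (x * y).
Proof.
case: b => /=; last by rewrite retrM => -> ->.
move=> [g [c [Cc ->]]] [h [d [Cd ->]]].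
exists (g * h), (c * d); split; first exact: link_groupM.
by rewrite -mulgA (mulgA c) link_group_comm // gp_inM !mulgA.
Qed.

Lemma vertex_factorV b x : vertex_factor b x -> vertex_factor b x^-1.
Proof.
case: b => /=; last by rewrite retrV => ->.
move=> [g [c [Cc ->]]]; exists g^-1, c^-1; split; first exact: link_groupV.
rewrite invgM -link_group_comm; last exact: link_groupV.
by congr (_ * _); apply: (mulgI (gp_in g)); rewrite mulgV -gp_inM mulgV gp_in1.
Qed.

Lemma vertex_factor_gen (P : K -> Prop) : P 1 ->
  (forall b x y, vertex_factor b x -> P y -> P (x * y)) -> forall x, P x.
Proof.
move=> P1 PM; elim/gp_ind=> // v a x; have [e|vu] := EM (v = u).
  subst v; apply: (PM true); exists a, 1; rewrite mulg1; split=> //.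
  exact: link_group1.
by apply: (PM false); exact: retr_id.
Qed.

(** The intersection of A and B is C: for g y in A, the retraction away from [u] kills g but fixes
    both y and g y, so g is trivial. *)
Lemma vertex_coreE x : (forall b, vertex_factor b x) <-> link_group x.
Proof.
split=> [Sx|Cx []]; [|exact: link_group_factor|exact: link_group_rest].
have [g [c [Cc xE]]] := Sx true; have := Sx false => /=.
rewrite xE retrM (link_group_rest Cc) => /mulIg.
by rewrite retr_triv => [<-|]; rewrite ?mul1g //; apply.
Qed.

Lemma syllable_true x : syllable vertex_factor true x ->
  exists (g : G u) y, [/\ g != 1, link_group y & x = gp_in g * y].
Proof.
move=> [[g [y [Cy xE]]] nx]; exists g, y; split=> //; apply/eqP => g1.
by apply: nx; rewrite xE g1 gp_in1 mul1g; exact: link_group_rest.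
Qed.

Lemma syllable_false x : syllable vertex_factor false x <->
  retr rest x = x /\ ~ link_group x.
Proof.
split=> -[rx nx]; split=> //.
  by move=> Cx; apply: nx; exact: link_group_factor.
by move=> Sx; apply: nx; apply/vertex_coreE => -[].
Qed.

Lemma syllable_gp_in (g : G u) :
  syllable vertex_factor true (gp_in g) <-> g <> 1.
Proof.
split=> [[_ /=] + g1|g1]; first by apply; rewrite g1 gp_in1 retr1.
split; first by exists g, 1; rewrite mulg1; split=> //; exact: link_group1.
rewrite /= retr_triv; last by apply.
by rewrite -(gp_in1 Gamma G u) => /gp_in_inj /esym.
Qed.

(** The concrete [head]: a product starting in B sends the empty word to a word with first label C,
    and one starting in A does not. *)
Definition vertex_head (x : K) : bool :=
  head_is link_group (val (gp_act x nil_word)).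

Lemma vertex_head_cons_true x s : syllable vertex_factor true x ->
  ~~ head_is link_group (val s) -> head_is link_group (val (gp_act x s)).
Proof.
move=> /syllable_true[g [y [g1 Cy ->]]] hs.
rewrite gp_actM endoM gp_act_in vertex_act_eq.
rewrite gp_act_rest; last exact: link_group_rest.
rewrite /= /mul_head; have hs' : ~~ head_is link_group (shift_word y (val s)).
  by rewrite -((shift_link_group y).2 Cy) head_is_shift.
have -> : split_head (shift_word y (val s)) = (1, shift_word y (val s)).
  by case: (shift_word _ _) hs' => [//|[A h] t] /= /negPf ->.
by rewrite mulg1 /cons_head (negPf g1) /= eqxx.
Qed.

Lemma vertex_head_syllable b x :
  syllable vertex_factor b x -> vertex_head x = b.
Proof.
case: b => xl; first exact: vertex_head_cons_true.
by rewrite /vertex_head gp_act_rest //; case: xl.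
Qed.

(** A syllable of B puts a letter labelled C in front. A syllable x of A is outside C, so it moves
    the leading label C to the different coset xC. *)
Lemma vertex_head_cons b x y : syllable vertex_factor b x ->
  vertex_head y = ~~ b -> vertex_head (x * y) = b.
Proof.
rewrite /vertex_head gp_actM endoM; case: b => xl /=.
  by move=> /negbT; exact: vertex_head_cons_true.
have [rx nx] := (syllable_false x).1 xl.
rewrite (gp_act_rest rx); case: (gp_act y _) => -[//|[A g] s] /= _ /eqP ->.
by apply/eqP => /shift_link_group.
Qed.

End VertexAction.
Arguments link_group {V} Gamma G u _.
Arguments vertex_factor {V} Gamma G u b _.

(** * Noncommuting conjugates *)

Lemma conj_noncommuting_iso (K K' : groupType) (f : K -> K') :
  group_iso f -> conj_noncommuting K -> conj_noncommuting K'.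
Proof.
move=> [[g fK gK] fM] Kn x y x1 y1.
have f1 : f 1 = 1 by apply: (mulgI (f 1)); rewrite -fM !mulg1.
have fV t : f t^-1 = (f t)^-1 by apply: (mulgI (f t)); rewrite -fM !mulgV.
have ne1 t : t <> 1 -> g t <> 1 by move=> t1 gt; apply: t1; rewrite -(gK t) gt.
have [z nz] := Kn _ _ (ne1 _ x1) (ne1 _ y1); exists (f z) => xy.
by apply: nz; apply: (can_inj fK); rewrite !fM fV !gK.
Qed.

Lemma card2_neq (T : Type) (x : T) : card_at_least 2 T -> exists y, y <> x.
Proof.
move=> [f f_inj]; have [f0|] := EM (f ord0 = x); last by exists (f ord0).
by exists (f ord_max); rewrite -f0 => /f_inj.
Qed.

Lemma card3_neq (T : Type) (x : T) : card_at_least 3 T ->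
  exists y z, [/\ y <> x, z <> x & y <> z].
Proof.
move=> [f f_inj]; pose f' (i : nat) := f (inord i).
have ff i j : (i < 3)%N -> (j < 3)%N -> i != j -> f' i <> f' j.
  by move=> i3 j3 + /f_inj /(congr1 val) /=; rewrite !inordK // => /eqP.
have [f0|f0] := EM (f' 0%N = x).
  by exists (f' 1%N), (f' 2%N); rewrite -f0; split; exact: ff.
have [f1|f1] := EM (f' 1%N = x).
  by exists (f' 0%N), (f' 2%N); rewrite -f1; split; exact: ff.
by exists (f' 0%N), (f' 1%N); split=> //; exact: ff.
Qed.

Lemma clos_refl_trans_inv (T : Type) (R : T -> T -> Prop) (P : T -> Prop) x y :
  (forall x y, R x y -> P x -> P y) -> clos_refl_trans T R x y -> P x -> P y.
Proof.
by move=> RP; elim=> [a b /RP//|//|a b c _ ab _ bc /ab/bc].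
Qed.

Section ConnectedComplement.
Variables (V : Type) (Gamma : graph V) (G : V -> groupType).
Hypothesis G_nontrivial : gp_nontrivial G.
Hypothesis coGamma_connected : graph_connected (complement Gamma).
Local Notation K := (graph_product Gamma G).
Local Notation gp_in := (gp_in Gamma).

Lemma vertex_nontrivial v : exists g : G v, g <> 1.
Proof. by case: G_nontrivial => _ /(_ v); exact: card2_neq. Qed.

Lemma graph_product_nontrivial : exists x : K, x <> 1.
Proof.
case: coGamma_connected => -[v] _; have [g g1] := vertex_nontrivial v.
by exists (gp_in g); rewrite -(gp_in1 Gamma G v);
  exact: contra_not (@gp_in_inj _ _ _ _ _ _) g1.
Qed.

(** Otherwise the component of [v] in the complement would be [v] alone. *)
Lemma coadj_neighbour v : exists w, coadj Gamma v w.
Proof.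
apply: contrapT => nv; case: G_nontrivial => /(card2_neq v) [w wv] _; apply: wv.
case: coGamma_connected => _ /(_ v w) vw.
apply: (clos_refl_trans_inv (P := fun w => w = v) _ vw) => // x y xy xv.
by case: nv; exists y; rewrite -xv.
Qed.

(* A conjugate [n] of [x] and all its conjugates by [G u] are fixed by the
   retraction to the link of [v]; as it kills [G u], [n] commutes with [G u]. *)
Lemma link_group_coadj v u (x : K) : coadj Gamma v u ->
  (forall z, link_group Gamma G v (z * x * z^-1)) ->
  forall z, link_group Gamma G u (z * x * z^-1).
Proof.
move=> [vu nvu] xv z; set n := z * x * z^-1.
have nu (g : G u) : gp_in g * n = n * gp_in g.
  have := xv (gp_in g * z).
  rewrite /link_group /= invgM !mulgA -(mulgA (gp_in g)) -(mulgA (gp_in g)) -/n.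
  rewrite 2!retrM (retrV _ (gp_in g)) (xv z : retr _ n = n).
  rewrite (@retr_triv _ Gamma G [set w | Gamma v w] u g nvu).
  rewrite invg1 mul1g mulg1 => e.
  by rewrite {2}e mulgVK.
have [g g1] := vertex_nontrivial u.
(* [n] lies in A, because [u] is not in the link of [v]. Outside C it would be a syllable of A that
   commutes with the syllable [gp_in g] of B. *)
apply: contrapT => nC.
apply: (@alternating_nocomm _ _ _ (@vertex_head_syllable V Gamma G u)
  (@vertex_head_cons V Gamma G u) (gp_in g) n) (nu g).
  by apply/alternating1/syllable_gp_in.
apply/alternating1/syllable_false; split=> //.
by apply: retr_fixS (xv z) => w /= vw wu; apply: nvu; rewrite -wu.
Qed.

Lemma link_group_core v (x : K) :
  (forall z, link_group Gamma G v (z * x * z^-1)) -> x = 1.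
Proof.
move=> xv; have xw w : link_group Gamma G w x.
  case: coGamma_connected => _ /(_ v w) vw.
  have := clos_refl_trans_inv (fun a b => @link_group_coadj a b x) vw xv.
  by move=> /(_ 1); rewrite invg1 mulg1 mul1g.
(* [x] is fixed by the retraction to the common link of the vertices in [l]. No vertex of [l] is in
   its own link, so this retraction kills [x]. *)
have [l lP] := retr_finite x; rewrite -(retr_fix_bigcap l xw).
apply: lP => w lw.
by move=> /(_ w lw); exact: adj_irrefl.
Qed.

Lemma graph_product_noncommuting : (exists v, card_at_least 3 (G v)) ->
  conj_noncommuting K.
Proof.
move=> [v /(card3_neq 1) [g1 [g2 [g1N g2N g12]]]] x y x1 y1.
have out t : t <> 1 -> exists p, ~ link_group Gamma G v (p * t * p^-1).
  move=> t1; apply: contrapT => /forallNP tv.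
  by apply/t1/(@link_group_core v) => z; exact: contrapT.
have [p xp] := out x x1; have [q yq] := out y y1.
(* [w] is outside the link of [v], so [h] gives the syllable of A; [g1] and [g2], available since
   [G v] has three elements, give the two syllables of B. *)
have [w [vw nvw]] := coadj_neighbour v; have [h h1] := vertex_nontrivial w.
have alphaP : syllable (vertex_factor Gamma G v) false (gp_in h).
  apply/syllable_false; split; first by rewrite retr_id // => /esym.
  rewrite /link_group /= retr_triv // -(gp_in1 Gamma G w).
  exact: contra_not (@gp_in_inj _ _ _ _ _ _) (nesym h1).
have g12S : ~ vertex_factor Gamma G v false (gp_in g1 * (gp_in g2)^-1).
  have -> : gp_in g1 * (gp_in g2)^-1 = gp_in (g1 / g2).
    by rewrite -[gp_in (g1 / g2)](mulgK (gp_in g2)) -gp_inM mulgVK.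
  have /(syllable_gp_in Gamma)[] // : g1 / g2 <> 1.
  exact: contra_not (@divg1_eq _ g1 g2) g12.
have [z nz] := not_core_nocomm (@vertex_factor1 V Gamma G v)
  (@vertex_factorM V Gamma G v) (@vertex_factorV V Gamma G v)
  (@vertex_factor_gen V Gamma G v) alphaP
  ((syllable_gp_in Gamma g1).2 g1N) ((syllable_gp_in Gamma g2).2 g2N) g12S
  (@vertex_head_syllable V Gamma G v) (@vertex_head_cons V Gamma G v)
  (contra_not (vertex_coreE _ _).1 xp) (contra_not (vertex_coreE _ _).1 yq).
exact: noncommuting_conj nz.
Qed.

End ConnectedComplement.

(** * Disconnected complement: direct factors and their exchange *)

Section DisconnectedComplement.
Variables (V : Type) (Gamma : graph V) (G : V -> groupType).
Hypothesis G_nontrivial : gp_nontrivial G.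
Local Notation K := (graph_product Gamma G).
Local Notation gp_in := (gp_in Gamma).

Definition trivial_ideal (I : Type) : ideal I.
Proof.
exists (fun A => A = set0) => // [A B -> ->|A B AB B0]; first by rewrite setU0.
by apply/seteqP; split=> // i /AB; rewrite B0.
Defined.

Variables (S : set V) (v w : V).
Hypotheses (Sv : S v) (Sw : ~ S w).
Hypothesis S_join : forall a b, S a -> ~ S b -> Gamma a b.

(** Together with [retr_comm], this splits [K] as the direct product of the subgroups on [S] and on
    its complement. *)
Lemma retr_join (x : K) : retr S x * retr (~` S) x = x.
Proof.
have CS a b : retr S a * retr (~` S) b = retr (~` S) b * retr S a :> K.
  exact: retr_comm S_join.
elim/gp_ind: x => [|a g x IHx]; first by rewrite !retr1 mulg1.
rewrite !retrM -mulgA (mulgA (retr S x)) CS -mulgA IHx mulgA; congr (_ * _).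
have [Sa|nSa] := EM (S a).
  by rewrite retr_id // retr_triv ?mulg1 //; exact.
by rewrite (retr_triv _ nSa) retr_id // mul1g.
Qed.

Definition swap_coord (a : pi_group (fun _ : bool => K)) :
    pi_group (fun _ : bool => K) :=
  fun i => retr S (a i) * retr (~` S) (a (~~ i)).

Lemma swap_coordM a b : swap_coord (a * b) = swap_coord a * swap_coord b.
Proof.
apply: functional_extensionality_dep => i.
have piM (c d : pi_group (fun _ : bool => K)) j : (c * d) j = c j * d j by [].
rewrite piM /swap_coord !piM !retrM -!mulgA; congr (_ * _).
by rewrite !mulgA (retr_comm _ _ S_join).
Qed.

Lemma swap_coordK : involutive swap_coord.
Proof.
move=> a; apply: functional_extensionality_dep => i.
rewrite /swap_coord negbK !retrM !retr_comp !setIid setICr setICl.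
have r0 (x : K) : retr set0 x = 1.
  by elim/gp_ind: x => [|c g x IHx]; rewrite ?retr1 //;
    rewrite retrM IHx retr_triv ?mulg1.
by rewrite !r0 mulg1 mul1g retr_join.
Qed.

Lemma graph_join_not_recognizing : ~ group_recognizes_coordinates K.
Proof.
set J := trivial_ideal bool; set R := reduced_product J (fun _ : bool => K).
move=> /(_ bool bool J J (fun _ => K) (fun _ => K)).
have Jp : proper_ideal J by move=> /seteqP[/(_ true)] /(_ I).
(* Over the trivial ideal every class is a singleton. *)
have repK a : rp_repr (rp_class J a) = a :> pi_group (fun _ : bool => K).
  apply: functional_extensionality_dep => i; apply: contrapT => ai.
  have := gc_repr (rp_congr J (fun _ : bool => K)) a.
  by move=> /seteqP[/(_ i)] /(_ ai).
have classK (x : R) : rp_class J (rp_repr x) = x by exact: reprK.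
pose Phi (x : R) : R := rp_class J (swap_coord (rp_repr x)).
have PhiK : involutive Phi.
  by move=> x; rewrite /Phi repK swap_coordK classK.
have PhiM x y : Phi (x * y) = Phi x * Phi y.
  rewrite /Phi -{1}(classK x) -{1}(classK y).
  rewrite -!(quotg_piM (rp_congr J (fun _ : bool => K))) repK.
  by rewrite swap_coordM.
move=> /(_ Jp Jp (fun=> erefl) (fun=> erefl) Phi) [].
  by split=> //; exists Phi.
move=> alpha [alpha_bij _ alphaI _] alphaP.
pose S0 := \pi_(powq J) [set true].
(* [alpha] preserves bottom, as bottom is its own meet with the preimage of bottom. Since [S0] is
   not bottom, the representative of [alpha S0] is nonempty. *)
have [i Ai] : exists i, (repr (alpha S0) : set bool) i.
  apply: contrapT => /forallNP nA; case: alpha_bij => beta alphaK betaK.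
  have alpha0 : alpha S0 = \pi_(powq J) set0.
    by rewrite -[LHS]reprK; congr (\pi_(powq J) _); apply/seteqP; split.
  have : S0 = \pi_(powq J) set0.
    apply: (can_inj alphaK); rewrite alpha0; have [_ _ _ -> _] := powqE J.
    rewrite -[in RHS](meet0x (beta Order.bottom)) alphaI betaK.
    by rewrite meetx0.
  by move=> /powqP; rewrite setY0 => /seteqP[/(_ true)] /(_ erefl).
(* The element has trivial coordinate at [true], so it agrees with 1 on [S0]; its image must then be
   trivial at [i]. *)
have swap1 (x : K) : swap_coord (fun j => if j then 1 else x) i = 1.
  set a := fun j => _.
  have /alphaP : rp_pi S0 (rp_class J a) = rp_pi S0 (rp_class J 1).
    by apply/rp_piP/seteqP; split=> // j /= [-> /=].
  rewrite -(reprK (alpha S0)) /Phi !repK => /rp_piP /seteqP[/(_ i) /= ni _].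
  apply: contrapT => ai; apply: ni; split=> //.
  by rewrite /swap_coord !retr1 mulg1.
have neq1 u (g : G u) : g <> 1 -> gp_in g <> 1.
  by rewrite -(gp_in1 Gamma G u); exact: contra_not (@gp_in_inj _ _ _ _ _ _).
(* At [true] the image retains the part of [x] outside [S], detected by [w]; at [false] the part in
   [S], detected by [v]. *)
case: i {Ai} swap1 => swap1.
  have [h /neq1] := card2_neq 1 (G_nontrivial.2 w); apply.
  by rewrite -[RHS](swap1 (gp_in h)) /swap_coord /= retr1 mul1g retr_id.
have [h /neq1] := card2_neq 1 (G_nontrivial.2 v); apply.
by rewrite -[RHS](swap1 (gp_in h)) /swap_coord /= retr1 mulg1 retr_id.
Qed.

End DisconnectedComplement.

Lemma recognizes_connected (V : Type) (Gamma : graph V) (G : V -> groupType) :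
  gp_nontrivial G -> group_recognizes_coordinates (graph_product Gamma G) ->
  graph_connected (complement Gamma).
Proof.
move=> Gn rec; split; first by case: Gn => -[f _] _; exists; exact: (f ord0).
move=> v w; apply: contrapT => vw.
(* The component of [v] in the complement graph: in [Gamma] its vertices are adjacent to all
   vertices outside it. *)
pose S := [set a | clos_refl_trans V (complement Gamma) v a].
apply: (@graph_join_not_recognizing _ Gamma _ Gn S v w _ vw _ rec).
  exact: rt_refl.
move=> a b Sa nSb; apply: contrapT => nab; apply: nSb.
have [<-//|ab] := EM (a = b).
by apply: rt_trans Sa _; apply: rt_step; split.
Qed.

(** * Supports in reduced products *)

Lemma order_iso_boolean (d d' : Order.disp_t) (A : ctbDistrLatticeType d)
    (B : ctbDistrLatticeType d') (f : A -> B) :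
  bijective f -> (forall x y, (f x <= f y)%O = (x <= y)%O) -> boolean_iso f.
Proof.
move=> [g fK gK] f_le.
have fI x y : f (x `&` y)%O = (f x `&` f y)%O.
  apply/le_anti; rewrite lexI !f_le leIl leIr /=.
  by rewrite -(gK (f x `&` f y)%O) f_le lexI -!f_le gK leIl leIr.
have fU x y : f (x `|` y)%O = (f x `|` f y)%O.
  apply/le_anti; rewrite leUx !f_le leUl leUr /= andbT.
  by rewrite -(gK (f x `|` f y)%O) f_le leUx -!f_le gK leUl leUr.
have f0 : f \bot%O = \bot%O.
  by apply/le_anti; rewrite le0x -(gK \bot%O) f_le le0x.
have f1 : f \top%O = \top%O.
  by apply/le_anti; rewrite lex1 /= -{1}(gK \top%O) f_le lex1.
split=> //; first by exists g.
move=> x; apply/le_anti/andP; split.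
  by rewrite -disj_leC -fI meetCx f0.
by rewrite -(meetx1 (~` f x)%O) -f1 -(joinxC x) fU meetUr meetCx join0x leIr.
Qed.

Section Support.
Variables (I : Type) (J : ideal I) (G : I -> groupType).
Local Notation R := (reduced_product J G).
Implicit Types (a b c : pi_group G) (x y z : R) (S : powq J).

Definition supp x : powq J := \pi_(powq J) [set i | rp_repr x i <> 1].

Lemma supp_class a : supp (rp_class J a) = \pi_(powq J) [set i | a i <> 1].
Proof.
apply/powqP; apply: idealS (gc_repr (rp_congr J G) a) => i.
move=> [[/= ri /contrapT ai]|[/= ai /contrapT ri]]; first by rewrite /= ai.
by rewrite -/(rp_repr (rp_class J a)) ri => /esym.
Qed.

Lemma rp_classM a b : rp_class J (a * b) = rp_class J a * rp_class J b.
Proof. exact: (quotg_piM (rp_congr J G)). Qed.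

Lemma rp_classV a : rp_class J a^-1 = (rp_class J a)^-1.
Proof.
apply: (mulgI (rp_class J a)); rewrite mulgV -rp_classM mulgV.
exact: (quotg_pi1 (rp_congr J G)).
Qed.

Lemma rp_classP a b : rp_class J a = rp_class J b <-> J [set i | a i <> b i].
Proof. exact: (quotgP (rp_congr J G)). Qed.

Lemma rp_reprK x : rp_class J (rp_repr x) = x.
Proof. exact: reprK. Qed.

Lemma pow_meet_bot (A B : set I) :
  (\pi_(powq J) A `&` \pi_(powq J) B = \bot)%O <-> J (A `&` B).
Proof.
have [_ <- _ <- _] := powqE J; rewrite (powqP J) setY0; exact: iff_refl.
Qed.

(** Noncommuting conjugators chosen at the coordinates where both entries are nontrivial assemble to
    a single [z], which forces these coordinates into the ideal. Conversely, at all other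
    coordinates one entry is trivial. *)
Lemma supp_disjoint x y : (forall i, conj_noncommuting (G i)) ->
  conj_commuting x y <-> (supp x `&` supp y = \bot)%O.
Proof.
move=> Gn; rewrite -(rp_reprK x) -(rp_reprK y).
move: (rp_repr x) (rp_repr y) => a b; rewrite !supp_class pow_meet_bot.
have piM c (d : pi_group G) i : (c * d) i = c i * d i by [].
have piV c i : c^-1 i = (c i)^-1 by [].
split=> [xy|Jab z].
  have wit i : exists z : G i, a i <> 1 -> b i <> 1 ->
      a i * (z * b i * z^-1) <> (z * b i * z^-1) * a i.
    have [a1|a1] := EM (a i = 1); first by exists 1.
    have [b1|b1] := EM (b i = 1); first by exists 1.
    by have [z] := Gn i _ _ a1 b1; exists z.
  pose c : pi_group G := fun i => projT1 (cid (wit i)).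
  have := xy (rp_class J c); rewrite -rp_classV -!rp_classM => /rp_classP.
  by apply: idealS => i /= [ai bi]; rewrite !piM !piV;
    exact: projT2 (cid (wit i)) ai bi.
rewrite -(rp_reprK z) -rp_classV -!rp_classM; apply/rp_classP.
apply: idealS Jab => i /=; rewrite !piM !piV => nab; split=> e1; apply: nab.
  by rewrite e1 mul1g mulg1.
by rewrite e1 mulg1 mulgV mulg1 mul1g.
Qed.

(** Translates the condition in [coordinate_respecting] into disjointness of supports. *)
Lemma rp_pi_supp S x y :
  rp_pi S x = rp_pi S y <-> (S `&` supp (x / y) = \bot)%O.
Proof.
rewrite -(rp_reprK x) -(rp_reprK y) -(reprK S).
move: (rp_repr x) (rp_repr y) => a b.
rewrite rp_piP -rp_classV -rp_classM supp_class pow_meet_bot.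
have -> // : [set i | (repr S : set I) i /\ a i <> b i] =
  (repr S : set I) `&` [set i | (a / b) i <> 1].
apply/seteqP; split=> i /= [Si nab]; split=> //; apply: contra_not nab.
  exact: divg1_eq.
by move=> e; rewrite [LHS](_ : _ = a i / b i) // e mulgV.
Qed.

Lemma supp_surj S : (forall i, exists g : G i, g <> 1) -> exists x, supp x = S.
Proof.
move=> G1; pose w i := projT1 (cid (G1 i)).
exists (rp_class J (fun i => if `[< (repr S : set I) i >] then w i else 1)).
rewrite supp_class -[RHS]reprK; congr (\pi_(powq J) _).
apply/seteqP; split=> i /=; case: asboolP => // _ _.
exact: projT2 (cid (G1 i)).
Qed.

(* The complement of [supp y] is the support of some element. *)
Lemma supp_le x y : (forall i, conj_noncommuting (G i)) ->
  (forall i, exists g : G i, g <> 1) ->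
  (supp x <= supp y)%O <-> forall z, conj_commuting z y -> conj_commuting z x.
Proof.
move=> Gn G1; split=> [xy z|xy].
  rewrite !supp_disjoint // => zy; apply/le_anti; rewrite le0x andbT -zy.
  by rewrite leI2.
have [z zE] := supp_surj (~` supp y)%O G1.
have := xy z; rewrite !supp_disjoint // zE meetCx => /(_ erefl) /eqP.
by rewrite meetC disj_leC complK.
Qed.

End Support.

(** * The isomorphism of power set quotients induced on supports *)

Section Recognition.
Variables (I I' : Type) (J : ideal I) (J' : ideal I').
Variables (G : I -> groupType) (H : I' -> groupType).
Hypothesis Gn : forall i, conj_noncommuting (G i).
Hypothesis Hn : forall i, conj_noncommuting (H i).
Hypothesis G1 : forall i, exists g : G i, g <> 1.
Hypothesis H1 : forall i, exists g : H i, g <> 1.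
Variable Phi : reduced_product J G -> reduced_product J' H.
Hypothesis Phi_iso : group_iso Phi.

Let PhiM : {morph Phi : x y / x * y}. Proof. by case: Phi_iso. Qed.

Let PhiV : {morph Phi : x / x^-1}.
Proof.
move=> x; apply: (mulgI (Phi x)); rewrite -PhiM !mulgV.
by apply: (mulgI (Phi 1)); rewrite -PhiM !mulg1.
Qed.

Let conj_commuting_Phi x y :
  conj_commuting (Phi x) (Phi y) <-> conj_commuting x y.
Proof.
case: Phi_iso => -[Psi PhiK PsiK] _; split=> xy z.
  by apply: (can_inj PhiK); rewrite !PhiM PhiV xy.
by rewrite -(PsiK z) -PhiV -!PhiM xy.
Qed.

Let supp_Phi_le x y : (supp (Phi x) <= supp (Phi y))%O = (supp x <= supp y)%O.
Proof.
case: Phi_iso => -[Psi PhiK PsiK] _.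
apply/idP/idP => /supp_le xy; apply/supp_le => // z.
  by rewrite -!conj_commuting_Phi; exact: xy.
by rewrite -(PsiK z) !conj_commuting_Phi; exact: xy.
Qed.

Lemma conj_noncommuting_coordinate_respecting : coordinate_respecting Phi.
Proof.
case: (Phi_iso) => -[Psi PhiK PsiK] _.
have [e eK] := choice (fun S : powq J => supp_surj S G1).
have [e' e'K] := choice (fun S : powq J' => supp_surj S H1).
(* [alpha] sends [S] to the support of the image of an element with support [S]; which element [e]
   picks does not matter. *)
have supp_Phi x y : supp x = supp y -> supp (Phi x) = supp (Phi y).
  by move=> xy; apply/le_anti; rewrite !supp_Phi_le xy !lexx.
have alpha_le S T : (supp (Phi (e S)) <= supp (Phi (e T)))%O = (S <= T)%O.
  by rewrite supp_Phi_le !eK.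
exists (fun S => supp (Phi (e S))) => [|S a b].
  apply: order_iso_boolean alpha_le; exists (fun S => supp (Psi (e' S))) => S.
    by rewrite -[RHS]eK; apply/le_anti; rewrite -!supp_Phi_le PsiK e'K !lexx.
  by rewrite (supp_Phi _ (Psi (e' S))) ?eK // PsiK.
(* Both equalities become commutation with all conjugates of the quotient of [a] and [b], or of its
   image, and [Phi] preserves this. *)
rewrite !rp_pi_supp -{1}(eK S) -PhiV -PhiM -!supp_disjoint //.
by rewrite conj_commuting_Phi.
Qed.

End Recognition.

Lemma connected_graph_products_recognize :
  recognizes_coordinates connected_graph_products.
Proof.
have cn (K : groupType) : connected_graph_products K ->
    conj_noncommuting K /\ exists x : K, x <> 1.
  move=> [V [Gamma [G [Gn Gc G3 [f f_iso]]]]]; split.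
    by apply: conj_noncommuting_iso f_iso _; exact: graph_product_noncommuting.
  have [x x1] := graph_product_nontrivial Gn Gc; case: f_iso => f_bij fM.
  have f1 : f 1 = 1 by apply: (mulgI (f 1)); rewrite -fM !mulg1.
  by exists (f x); rewrite -f1 => /(bij_inj f_bij).
move=> I I' J J' G H _ _ GP HP Phi Phi_iso.
apply: conj_noncommuting_coordinate_respecting Phi_iso => i.
- exact: (cn _ (GP i)).1.
- exact: (cn _ (HP i)).1.
- exact: (cn _ (GP i)).2.
- exact: (cn _ (HP i)).2.
Qed.

Theorem theorem4p15 :
  (forall (V : Type) (Gamma : graph V) (G : V -> groupType),
     gp_nontrivial G ->
     (exists v : V, card_at_least 3 (G v)) ->
     (group_recognizes_coordinates (graph_product Gamma G) <->
      graph_connected (complement Gamma)))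
  /\ recognizes_coordinates connected_graph_products.
Proof.
split=> [V Gamma G Gn G3|]; last exact: connected_graph_products_recognize.
split=> [|Gc]; first exact: recognizes_connected.
have gp_class K : K = graph_product Gamma G -> connected_graph_products K.
  move=> ->; exists V, Gamma, G; split=> //.
  by exists id; split=> //; exists id.
move=> I I' J J' H H' Jp Jp' HP HP' Phi Phi_iso.
apply: connected_graph_products_recognize Phi_iso => // i.
  exact: gp_class (HP i).
exact: gp_class (HP' i).
Qed.
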